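(* Let $r\ge 1$ be an integer, let $k_{1},\dots,k_{r}\ge 1$ be integers, and let $n\ge 0$ be an integer. Then $$B_{n}^{(k_{1},k_{2},\dots,k_{r})}= \sum_{l=0}^{n}\sum_{m=r}^{l+r}\frac{\binom{n}{l}B_{n-l}^{(r)}(-1)^{n-r-m}}{r!\binom{l+r}{r}}S_{2}(l+r,m)\,S_{1}^{(k_{1},\dots,k_{r})}(m,r).$$
   Context: For integers $k_1,\dots,k_r$ ($r\ge 1$), the multiple logarithm is $\mathrm{Li}_{k_{1},\dots,k_{r}}(z)=\sum_{0<m_{1}<m_{2}<\cdots<m_{r}}\frac{z^{m_{r}}}{m_{1}^{k_{1}}m_{2}^{k_{2}}\cdots m_{r}^{k_{r}}}$ for $|z|<1$ (the sum is over positive integers; it may equally be regarded as a formal power series in $z$, divisible by $z^r$). The multi-Stirling numbers of the first kind $S_{1}^{(k_{1},\dots,k_{r})}(n,r)$ are defined by $\mathrm{Li}_{k_{1},\dots,k_{r}}(t)=\sum_{n=r}^{\infty}S_{1}^{(k_{1},\dots,k_{r})}(n,r)\frac{t^{n}}{n!}$. The multi-Bernoulli numbers $B_{m}^{(k_{1},\dots,k_{r})}$ are defined by $\frac{\mathrm{Li}_{k_{1},\dots,k_{r}}(z)}{z^{r}}\Big|_{z=1-e^{-t}}=\sum_{m=0}^{\infty}B_{m}^{(k_{1},\dots,k_{r})}\frac{t^{m}}{m!}$. The Bernoulli numbers of order $r$, denoted $B_n^{(r)}$ (here the superscript $(r)$ is the order, not a multi-index), are defined by $\left(\frac{t}{e^{t}-1}\right)^{r}=\sum_{n=0}^{\infty}B_{n}^{(r)}\frac{t^{n}}{n!}$.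 The Stirling numbers of the second kind $S_2(n,k)$ are defined by $\frac{1}{k!}(e^{t}-1)^{k}=\sum_{n=k}^{\infty}S_{2}(n,k)\frac{t^{n}}{n!}$. *)

(* Defs.v *)
From HB Require Import structures.
From mathcomp Require Import all_boot all_order all_algebra.

Set Implicit Arguments.
Unset Strict Implicit.
Unset Printing Implicit Defensive.

Import Order.TTheory GRing.Theory Num.Theory.

Local Open Scope ring_scope.

(* A formal power series is the function giving its coefficients: the
   coefficient of t^n in f is f n. Equality of series is pointwise equality. *)
Definition fps (F : fieldType) : Type := nat -> F.

Definition fps_one {F : fieldType} : fps F := fun n => (n == 0%N)%:R.

Definition fps_sub {F : fieldType} (f g : fps F) : fps F := fun n => f n - g n.

Definition fps_scale {F : fieldType} (a : F) (f : fps F) : fps F :=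
  fun n => a * f n.

Definition fps_mul {F : fieldType} (f g : fps F) : fps F :=
  fun n => \sum_(i < n.+1) f i * g (n - i)%N.

Definition fps_pow {F : fieldType} (f : fps F) (n : nat) : fps F :=
  iter n (fps_mul f) fps_one.

(* f / t^d; meaningful when t^d divides f, see fps_shiftK. *)
Definition fps_shift {F : fieldType} (d : nat) (f : fps F) : fps F :=
  fun n => f (n + d)%N.

(* f(g(t)); meaningful when g 0 = 0, and then g^j has no term of degree < j,
   so the terms f j * g^j with j > n do not contribute to degree n. *)
Definition fps_comp {F : fieldType} (f g : fps F) : fps F :=
  fun n => \sum_(j < n.+1) f j * fps_pow g j n.

(* The first n coefficients of 1 / f, computed by solving f * g = 1 degree by
   degree; meaningful when f 0 != 0, see fps_mulV. *)
Fixpoint fps_inv_seq {F : fieldType} (f : fps F) (n : nat) : seq F :=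
  if n is m.+1 then
    let s := fps_inv_seq f m in
    rcons s ((f 0%N)^-1 *
             ((m == 0%N)%:R - \sum_(i < m) s`_i * f (m - i)%N))
  else [::].

Definition fps_inv {F : fieldType} (f : fps F) : fps F :=
  fun n => (fps_inv_seq f n.+1)`_n.

(* The coefficient c_n in the expansion f = \sum_n c_n t^n / n!. *)
Definition egf_coef (f : fps rat) (n : nat) : rat := n`!%:R * f n.

(* exp (a t) *)
Definition fps_exp (a : rat) : fps rat := fun n => a ^+ n / n`!%:R.

(* exp t - 1 *)
Definition fps_expm1 : fps rat := fps_sub (fps_exp 1) fps_one.

(* Li_{k_1, ..., k_r}. The coefficient of z^N collects the tuples
   0 < m_1 < ... < m_r with m_r = N; all their entries are at most N, so they
   can be taken in 'I_N.+1. *)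
Definition multiLi (r : nat) (k : r.-tuple int) : fps rat := fun N =>
  \sum_(m : r.-tuple 'I_N.+1 |
          path ltn 0%N (map val m) && (last 0%N (map val m) == N))
    (\prod_(i < r) (tnth m i)%:R ^ tnth k i)^-1.

(* S_1^(k_1, ..., k_r)(n, r) *)
Definition multi_stirling1 (r : nat) (k : r.-tuple int) (n : nat) : rat :=
  egf_coef (multiLi k) n.

(* S_2(n, k) *)
Definition stirling2 (n k : nat) : rat :=
  egf_coef (fps_scale (k`!%:R)^-1 (fps_pow fps_expm1 k)) n.

(* B_n^(r), where r is the order; t / (exp t - 1) is read as the inverse of
   (exp t - 1) / t. *)
Definition bernoulli_order (r n : nat) : rat :=
  egf_coef (fps_pow (fps_inv (fps_shift 1 fps_expm1)) r) n.

(* B_m^(k_1, ..., k_r), from Li_{k_1, ..., k_r}(z) / z^r at z = 1 - exp (- t) *)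
Definition multi_bernoulli (r : nat) (k : r.-tuple int) (m : nat) : rat :=
  egf_coef (fps_comp (fps_shift r (multiLi k))
                     (fps_sub fps_one (fps_exp (-1)))) m.

Lemma size_fps_inv_seq (F : fieldType) (f : fps F) (n : nat) :
  size (fps_inv_seq f n) = n.
Proof. by elim: n => //= n IHn; rewrite size_rcons IHn. Qed.

Lemma nth_fps_inv_seq (F : fieldType) (f : fps F) (n i : nat) :
  (i < n)%N -> (fps_inv_seq f n)`_i = fps_inv f i.
Proof.
elim: n => // n IHn; rewrite ltnS leq_eqVlt => /orP[/eqP-> //|lt_in].
by rewrite /= nth_rcons size_fps_inv_seq lt_in IHn.
Qed.

Lemma fps_mulV (F : fieldType) (f : fps F) :
  f 0%N != 0 -> fps_mul (fps_inv f) f =1 fps_one.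
Proof.
move=> f0 n; rewrite /fps_mul big_ord_recr /= subnn {2}/fps_inv /=.
rewrite nth_rcons size_fps_inv_seq ltnn eqxx mulrC mulVKf //.
under [X in _ + (_ - X)]eq_bigr => i _ do rewrite nth_fps_inv_seq //.
by rewrite addrC subrK.
Qed.

Lemma fps_shiftK (F : fieldType) (d : nat) (f : fps F) :
    (forall n, (n < d)%N -> f n = 0) ->
  fps_mul (fps_shift d f) (fun n => (n == d)%:R) =1 f.
Proof.
move=> f_low n; rewrite /fps_mul /fps_shift.
have [lt_nd | le_dn] := ltnP n d.
  rewrite f_low // big1 // => i _; case: eqP => [E|]; rewrite ?mulr0 //.
  by move: lt_nd; rewrite -E ltnNge leq_subr.
have lt_n : (n - d < n.+1)%N by rewrite ltnS leq_subr.
rewrite (bigD1 (Ordinal lt_n)) //= subKn // eqxx mulr1 subnK // big1 ?addr0 //.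
move=> i /eqP ne_i; case: eqP => [E|]; rewrite ?mulr0 //.
by case: ne_i; apply: val_inj; rewrite /= -E subKn // -ltnS.
Qed.

Lemma multiLi_low (r : nat) (k : r.-tuple int) (N : nat) :
  (N < r)%N -> multiLi k N = 0.
Proof.
move=> lt_Nr; rewrite /multiLi big_pred0 // => m; apply/negP.
case/andP=> m_path /eqP m_last.
have bound (s : seq nat) x : path ltn x s -> (x + size s <= last x s)%N.
  elim: s x => [|y s IHs] x /=; first by rewrite addn0.
  case/andP=> lt_xy /IHs; apply: leq_trans.
  by rewrite addnS -addSn leq_add2r.
by have := bound _ _ m_path; rewrite m_last size_map size_tuple leqNgt lt_Nr.
Qed.

(* Main.v *)
Require Import Defs.
From mathcomp Require Import all_boot all_order all_algebra.
From mathcomp Require Import ring.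

(** Put [u = 1 - exp (- t)] and [E = exp t - 1].  Dividing [Li] by [z^r] before
    substituting [z = u] amounts to dividing [Li(u)] by [u^r] afterwards
    ([fps_comp_shift]), and [u(t) = - E(- t)].  Hence the generating series of
    the multi-Bernoulli numbers is the product of

    - [(t / u)^r], which is [(t / E)^r] at [- t] and so generates
      [(-1)^n B_n^(r)], and
    - [Li(u) / t^r], where [Li(u) = \sum_m Li_m u^m] and each power [u^m] is
      [(-1)^m E^m] at [- t].  As [E^m] generates [m! S_2(_, m)] and
      [m! Li_m = S_1(m, r)], the coefficients of [Li(u)] are
      [\sum_m (-1)^(N + m) S_2(N, m) S_1(m, r) / N!].

    The stated formula is the coefficient of [t^n / n!] in this product
    ([multi_bernoulli_convolution]); the binomials come from the factorials that
    normalize the coefficients.  The division by [u^r] is carried out in two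
    steps: cancelling [t^r], which is exact because [E^r] is divisible by [t^r],
    and multiplying by the inverse of [(E / t)^r], the constant term of [E / t]
    being 1. *)

Import Order.TTheory GRing.Theory Num.Theory.

Local Open Scope ring_scope.

Section FormalSeries.

Set Implicit Arguments.
Unset Strict Implicit.

Variable F : fieldType.
Implicit Types f g h : fps F.

Lemma eq_fps_mul f f' g g' :
  f =1 f' -> g =1 g' -> fps_mul f g =1 fps_mul f' g'.
Proof. by move=> ff' gg' n; apply: eq_bigr => i _; rewrite ff' gg'. Qed.

(** The coefficient of degree [n] of a product only sees the factors up to
    degree [n], so ring identities for series follow from those for
    polynomials. *)
Lemma fps_mul_coef f g (p q : {poly F}) n :
    (forall i, (i <= n)%N -> f i = p`_i) ->
    (forall i, (i <= n)%N -> g i = q`_i) ->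
  fps_mul f g n = (p * q)`_n.
Proof.
move=> fp gq; rewrite coefM; apply: eq_bigr => i _.
by rewrite fp ?gq ?leq_subr // -ltnS.
Qed.

Lemma coef_trunc f n i :
  (i <= n)%N -> f i = (\poly_(j < n.+1) f j)`_i.
Proof. by move=> le_in; rewrite coef_poly ltnS le_in. Qed.

Lemma fps_mulC f g : fps_mul f g =1 fps_mul g f.
Proof.
move=> n; have tr h := @coef_trunc h n.
by rewrite (fps_mul_coef (tr f) (tr g)) mulrC (fps_mul_coef (tr g) (tr f)).
Qed.

Lemma fps_mulA f g h : fps_mul f (fps_mul g h) =1 fps_mul (fps_mul f g) h.
Proof.
move=> n; have tr (k : fps F) i := @coef_trunc k n i.
have trM (k l : fps F) i : (i <= n)%N ->
    fps_mul k l i = (\poly_(j < n.+1) k j * \poly_(j < n.+1) l j)`_i.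
  by move=> le_in; apply: fps_mul_coef => j /leq_trans/(_ le_in)/tr.
by rewrite (fps_mul_coef (tr f) (trM g h)) mulrA (fps_mul_coef (trM f g) (tr h)).
Qed.

Lemma fps_mul1 f : fps_mul fps_one f =1 f.
Proof.
move=> n; rewrite /fps_mul big_ord_recl mul1r subn0 big1 ?addr0 // => i _.
by rewrite /fps_one mul0r.
Qed.

Lemma fps_powD f m n :
  fps_mul (fps_pow f m) (fps_pow f n) =1 fps_pow f (m + n).
Proof.
elim: m => [|m IHm] i; first by rewrite fps_mul1.
by rewrite -fps_mulA; apply: eq_fps_mul.
Qed.

Lemma fps_pow_one n : fps_pow fps_one n =1 (fps_one : fps F).
Proof. by elim: n => // n IHn i; rewrite /= fps_mul1. Qed.

Lemma eq_fps_pow f g n : f =1 g -> fps_pow f n =1 fps_pow g n.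
Proof. by move=> fg; elim: n => // n IHn; apply: eq_fps_mul. Qed.

Lemma fps_powMn f g n :
  fps_pow (fps_mul f g) n =1 fps_mul (fps_pow f n) (fps_pow g n).
Proof.
elim: n => [|n IHn] i; first by rewrite fps_mul1.
transitivity (fps_mul (fps_mul f g) (fps_mul (fps_pow f n) (fps_pow g n)) i).
  exact: eq_fps_mul.
rewrite -!fps_mulA; apply: eq_fps_mul => // {}i; rewrite !fps_mulA.
by apply: eq_fps_mul => // {}i; apply: fps_mulC.
Qed.

Lemma fps_pow_low f j n : f 0%N = 0 -> (n < j)%N -> fps_pow f j n = 0.
Proof.
move=> f0; elim: j n => // j IHj n; rewrite ltnS => le_nj.
rewrite /= /fps_mul big1 // => -[[|i] lt_in] _ /=; first by rewrite f0 mul0r.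
rewrite IHj ?mulr0 //; apply: leq_trans le_nj.
by rewrite ltn_subrL (leq_trans (ltn0Sn i) lt_in).
Qed.

(** This is [f (g / t^d) = f g / t^d] for [g] divisible by [t^d]. *)
Lemma fps_mul_shift d f g : (forall i, (i < d)%N -> g i = 0) ->
  fps_mul f (fps_shift d g) =1 fps_shift d (fps_mul f g).
Proof.
move=> g_low n; rewrite /fps_shift /fps_mul -(big_mkord xpredT (fun i => f i * g (n - i + d)%N)).
rewrite -(big_mkord xpredT (fun i => f i * g (n + d - i)%N)).
rewrite (@big_cat_nat _ _ _ n.+1 0 (n + d).+1) //=; last by rewrite ltnS leq_addr.
rewrite [X in _ = _ + X]big_nat_cond [X in _ = _ + X]big1 ?addr0.
  by apply: eq_big_nat => i /andP[_]; rewrite ltnS => le_in; rewrite addnBAC.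
move=> i /andP[/andP[lt_ni le_i] _]; rewrite g_low ?mulr0 //.
by rewrite ltn_subLR ?ltn_add2r.
Qed.

Lemma fps_pow_shift1 f j : f 0%N = 0 ->
  fps_shift j (fps_pow f j) =1 fps_pow (fps_shift 1 f) j.
Proof.
move=> f0; elim: j => [|j IHj] n; first by rewrite /fps_shift addn0.
have f_low i : (i < 1)%N -> f i = 0 by case: i.
transitivity (fps_shift 1 (fps_mul (fps_shift j (fps_pow f j)) f) n).
  rewrite /fps_shift fps_mulC -[RHS]/(fps_mul f _ (n + 1)%N).
  rewrite fps_mul_shift => [|i]; last exact: fps_pow_low.
  by rewrite /fps_shift -addnA add1n.
by rewrite -fps_mul_shift // fps_mulC; apply: eq_fps_mul.
Qed.

(** Substituting [b t] for [t] is a ring morphism. *)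
Lemma fps_mul_rescale (b : F) f g :
  fps_mul (fun n => b ^+ n * f n) (fun n => b ^+ n * g n)
    =1 (fun n => b ^+ n * fps_mul f g n).
Proof.
move=> n; rewrite /fps_mul big_distrr; apply: eq_bigr => i _ /=.
by rewrite mulrACA -exprD subnKC // -ltnS.
Qed.

Lemma fps_pow_rescale (a b : F) f g j :
    (forall n, g n = a * (b ^+ n * f n)) ->
  forall n, fps_pow g j n = a ^+ j * (b ^+ n * fps_pow f j n).
Proof.
move=> def_g; elim: j => [|j IHj] n.
  by case: n => [|n]; rewrite /fps_pow /= /fps_one /= ?mulr0 // !mul1r.
rewrite /= -fps_mul_rescale /fps_mul big_distrr /=; apply: eq_bigr => i _.
by rewrite def_g IHj exprS mulrACA.
Qed.

(** The series form of [(f(z) / z^d) z^d = f(z)] at [z = g(t)]. *)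
Lemma fps_comp_shift d f g : g 0%N = 0 ->
    (forall i, (i < d)%N -> f i = 0) ->
  fps_mul (fps_comp (fps_shift d f) g) (fps_pow g d) =1 fps_comp f g.
Proof.
move=> g0 f_low n.
(* No power of g beyond g^n contributes up to degree n, which makes the range
   of j independent of i. *)
have compE i : (i < n.+1)%N ->
    fps_comp (fps_shift d f) g i = \sum_(j < n.+1) f (j + d)%N * fps_pow g j i.
  move=> lt_in; rewrite /fps_comp /fps_shift.
  rewrite (big_ord_widen n.+1 (fun j => f (j + d)%N * fps_pow g j i)) //.
  rewrite big_mkcond; apply: eq_bigr => j _.
  by case: ltnP => // le_ij; rewrite fps_pow_low ?mulr0.
transitivity (\sum_(j < n.+1) f (j + d)%N * fps_pow g (j + d) n).
  rewrite /fps_mul; under eq_bigr => i _ do rewrite compE // big_distrl /=.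
  rewrite exchange_big; apply: eq_bigr => j _ /=.
  rewrite -fps_powD /fps_mul big_distrr; apply: eq_bigr => i _ /=.
  by rewrite mulrA.
(* Both sides are the sum of f m * g^m over m < n + 1 + d. *)
transitivity (\sum_(0 <= m < n.+1 + d) f m * fps_pow g m n).
  rewrite (@big_cat_nat _ _ _ d) ?leq_addl //=.
  rewrite [X in _ = X + _]big_nat [X in _ = X + _]big1 ?add0r.
    by rewrite -[X in index_iota X]add0n big_addn addnK big_mkord.
  by move=> m /andP[_ lt_md]; rewrite f_low ?mul0r.
rewrite (@big_cat_nat _ _ _ n.+1) ?leq_addr //= big_mkord.
rewrite [X in _ + X]big_nat [X in _ + X]big1 ?addr0 // => m /andP[lt_nm _].
by rewrite fps_pow_low ?mulr0.
Qed.

End FormalSeries.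

(** In the shape [a f(b t)] expected by [fps_pow_rescale], with [a = b = -1], so
    that the powers of [1 - exp (- t)] reduce to those of [exp t - 1]. *)
Lemma one_sub_expN n :
  fps_sub fps_one (fps_exp (-1)) n = -1 * ((-1) ^+ n * fps_expm1 n).
Proof.
rewrite /fps_expm1 /fps_sub /fps_exp /fps_one expr1n; case: n => [|n] /=.
  by rewrite !expr0 divr1 subrr !mulr0.
by rewrite sub0r subr0 mulN1r div1r.
Qed.

Lemma one_sub_expN_pow j n :
  fps_pow (fps_sub fps_one (fps_exp (-1))) j n
    = (-1) ^+ j * ((-1) ^+ n * fps_pow fps_expm1 j n).
Proof. exact: fps_pow_rescale one_sub_expN n. Qed.

Lemma fps_expm1_0 : fps_expm1 0%N = 0.
Proof. by rewrite /fps_expm1 /fps_sub /fps_exp /fps_one expr0 divr1 subrr. Qed.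

(** With [u = 1 - exp (- t)], this is [Li(u) / u^r = (Li(u) / t^r) (t / u)^r],
    in which [(t / u)^r] is [(t / (exp t - 1))^r] at [- t]: indeed
    [(Li(u) / u^r) (u / t)^r = Li(u) / t^r], and [u / t] is invertible. *)
Lemma multi_bernoulli_convolution r (k : r.-tuple int) :
  fps_comp (fps_shift r (multiLi k)) (fps_sub fps_one (fps_exp (-1)))
    =1 fps_mul
         (fps_shift r
           (fps_comp (multiLi k) (fps_sub fps_one (fps_exp (-1)))))
         (fun n => (-1) ^+ n
            * fps_pow (fps_inv (fps_shift 1 fps_expm1)) r n).
Proof.
set u := fps_sub _ _; set e := fps_shift 1 _; set A := fps_comp _ u.
have u0 : u 0%N = 0 by rewrite /u one_sub_expN fps_expm1_0 !mulr0.
have e0 : e 0%N != 0 by [].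
have shift_u : fps_shift r (fps_pow u r) =1 fun n => (-1) ^+ n * fps_pow e r n.
  move=> n; rewrite -fps_pow_shift1 ?fps_expm1_0 // /fps_shift one_sub_expN_pow.
  by rewrite exprD -mulrA mulrCA signrMK.
have LiE : fps_mul A (fun n => (-1) ^+ n * fps_pow e r n)
    =1 fps_shift r (fps_comp (multiLi k) u).
  move=> n; transitivity (fps_shift r (fps_mul A (fps_pow u r)) n).
    rewrite -fps_mul_shift => [|i]; last exact: fps_pow_low.
    by apply: eq_fps_mul.
  by rewrite /fps_shift fps_comp_shift // => i; apply: multiLi_low.
move=> n; symmetry.
transitivity (fps_mul (fps_mul A (fun n => (-1) ^+ n * fps_pow e r n))
                      (fun n => (-1) ^+ n * fps_pow (fps_inv e) r n) n).
  by apply: eq_fps_mul.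
rewrite -fps_mulA -[RHS]fps_mul1 fps_mulC; apply: eq_fps_mul => // {}n.
rewrite fps_mul_rescale fps_mulC -fps_powMn.
rewrite (eq_fps_pow _ (fps_mulV e0)) fps_pow_one /fps_one.
by case: n => [|n]; rewrite ?mulr0 ?mul1r.
Qed.

Lemma natf_fact_neq0 n : n`!%:R != 0 :> rat.
Proof. by rewrite pnatr_eq0 -lt0n fact_gt0. Qed.

(** With [u = 1 - exp (- t)], the powers [u^m] expand by Stirling numbers of the
    second kind, and [u^m] is weighted by the coefficient of [z^m] in [Li], a
    Stirling number of the first kind; the factors [m!] of the two cancel. *)
Lemma multiLi_comp_coef r (k : r.-tuple int) N : (r <= N)%N ->
  fps_comp (multiLi k) (fps_sub fps_one (fps_exp (-1))) N
    = (N`!%:R)^-1 * \sum_(r <= m < N.+1)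
        (-1) ^+ (N + m) * stirling2 N m * multi_stirling1 k m.
Proof.
move=> le_rN; rewrite /fps_comp.
rewrite -(big_mkord xpredT (fun m => multiLi k m * fps_pow _ m N)).
rewrite (@big_cat_nat _ _ _ r) ?leqW //= big_nat big1 ?add0r; last first.
  by move=> m /andP[_ lt_mr]; rewrite multiLi_low ?mul0r.
rewrite big_distrr; apply: eq_bigr => m _ /=.
rewrite one_sub_expN_pow /stirling2 /multi_stirling1 /egf_coef /fps_scale exprD.
by field; rewrite !natf_fact_neq0.
Qed.

Lemma exprz_sign_sub (a b c : nat) :
  (-1) ^ (a%:Z - b%:Z - c%:Z) = (-1) ^+ (a + b + c) :> rat.
Proof.
have N1_unit : (-1 : rat) \is a GRing.unit by rewrite unitfE.
by rewrite !expfzDr // -!exprz_inv invrN1 -!exprnP -!exprD.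
Qed.

Theorem theorem2 (r : nat) (hr : (1 <= r)%N) (k : r.-tuple int)
    (hk : forall i : 'I_r, 1 <= tnth k i) (n : nat) :
  multi_bernoulli k n =
  \sum_(0 <= l < n.+1) \sum_(r <= m < (l + r).+1)
    ('C(n, l)%:R * bernoulli_order r (n - l)
       * (-1) ^ (n%:Z - r%:Z - m%:Z)) / (r`!%:R * 'C(l + r, r)%:R)
    * stirling2 (l + r) m * multi_stirling1 k m.
Proof.
rewrite /multi_bernoulli /egf_coef multi_bernoulli_convolution /fps_mul.
rewrite big_distrr big_mkord; apply: eq_bigr => -[l lt_ln] _ /=.
have le_ln : (l <= n)%N by rewrite -ltnS.
rewrite /fps_shift multiLi_comp_coef ?leq_addl // mulrCA -!mulrA mulrC.
rewrite !(big_distrl, big_distrr) /=; apply: eq_bigr => m _.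
rewrite /bernoulli_order /egf_coef.
(* The sign of the Li(u) factor times the sign of the Bernoulli factor. *)
have -> : (-1) ^ (n%:Z - r%:Z - m%:Z)
    = (-1) ^+ (l + r + m) * (-1) ^+ (n - l) :> rat.
  rewrite exprz_sign_sub -exprD; congr (_ ^+ _).
  by rewrite [RHS]addnC !addnA subnK.
have binn : 'C(n, l)%:R = n`!%:R / (l`!%:R * (n - l)`!%:R) :> rat.
  by rewrite -(bin_fact le_ln) !natrM mulfK // mulf_neq0 ?natf_fact_neq0.
have binr : 'C(l + r, r)%:R = (l + r)`!%:R / (r`!%:R * l`!%:R) :> rat.
  rewrite -(bin_fact (leq_addl l r)) addnK !natrM mulfK //.
  by rewrite mulf_neq0 ?natf_fact_neq0.
by rewrite binn binr; field; rewrite !natf_fact_neq0.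
Qed.
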